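(* Let $G=(V,E,w)$ be a finite weighted directed tree. Fix distinct $x,y\in V$ with $d(x,y)=d$ and let $(z_i)_{i=0}^d$ be the unique undirected path with $z_0=x$ and $z_d=y$. For a subset $I\subseteq[d]=\{1,\dots,d\}$ let $G_I$ be the graph obtained from $G$ by removing all (directed) edges between $z_{i-1}$ and $z_i$ for all $i\in I$, and denote its $|I|+1$ connected components by $G_I^1,\dots,G_I^{|I|+1}$. Then for every $q>0$, $$U_q^{(G)}(x,y)=\frac{1}{Z_G(q)}\left(\sum_{k=1}^{d}(-1)^{k+1}\sum_{I\in\binom{[d]}{k}}\prod_{i=1}^{k+1}Z_{G_I^i}(q)\right),$$ where $\binom{[d]}{k}$ is the collection of $k$-element subsets of $[d]$. In particular, if $d(x,y)=1$, then $$U_q^{(G)}(x,y)=\frac{Z_x(q)Z_y(q)}{Z_G(q)},$$ where $Z_x(q)$ and $Z_y(q)$ are the partition functions of the two connected components (containing $x$ and $y$ respectively) of the graph obtained by removing the edges between $x$ and $y$.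
   Context: A weighted directed graph $G=(V,E,w)$ has a finite vertex set $V$, a set $E\subseteq\{(x,y):x,y\in V\}$ of directed edges and a weight function $w:E\to[0,\infty)$. It is a weighted directed tree if its underlying undirected simple graph is a tree (each undirected edge may correspond to a directed edge in one or both directions). $d(x,y)$ is the minimum number of edges on an undirected path from $x$ to $y$; connected components are taken ignoring orientation. A rooted spanning forest of $G$ is a subset $F\subseteq E$ such that each vertex has at most one outgoing edge in $F$ and $F$ contains no directed cycle; its roots are the vertices without outgoing edge in $F$, $r(F)$ is the number of roots, and $\mathcal{F}_G$ is the set of rooted spanning forests. The partition function of $G$ is $Z_G(q)=\sum_{F\in\mathcal{F}_G}q^{r(F)}w(F)$ with $w(F)=\prod_{e\in F}w(e)$, and for $q>0$ the random rooted spanning forest $\Phi_q$ of $G$ has law $\mathbb{P}(\Phi_q=F)=q^{r(F)}w(F)/Z_G(q)$. $U_q^{(G)}(x,y)$ is the probability that $x$ and $y$ belong to different trees (connected components) of $\Phi_q$. *)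

(* Defs.v *)
From HB Require Import structures.
From mathcomp Require Import all_boot all_order all_algebra.
From mathcomp Require Import boolp reals.

Set Implicit Arguments.
Unset Strict Implicit.
Unset Printing Implicit Defensive.

Import Order.TTheory GRing.Theory Num.Theory.

Local Open Scope ring_scope.

(* The vertex set is a subset of an ambient finite type, so that subgraphs of
   G keep the type of G. The weight is a total function, but only its values
   on [eset] are ever used. Self-loops are allowed in [eset]. *)
Record wdigraph (R : realType) (T : finType) := WDigraph {
  vset : {set T};
  eset : {set T * T};
  wt : T * T -> R;
  eset_sub : eset \subset setX vset vset;
  wt_ge0 : forall e, e \in eset -> 0 <= wt e
}.

Section Relations.
Variable T : finType.
Implicit Type E : {set T * T}.

(* Adjacency in the underlying undirected simple graph: loops are dropped. *)
Definition uadj E : rel T :=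
  fun u v => (u != v) && (((u, v) \in E) || ((v, u) \in E)).

Definition dadj E : rel T := fun u v => (u, v) \in E.

(* [x :: s] is a simple undirected path from x to y, with [size s] edges. *)
Definition upath E (x y : T) (s : seq T) : bool :=
  [&& path (uadj E) x s, last x s == y & uniq (x :: s)].

Definition is_udist E (x y : T) (d : nat) : Prop :=
  (exists2 s, upath E x y s & size s = d) /\
  (forall s, upath E x y s -> (d <= size s)%N).

End Relations.

Section Graphs.
Variables (R : realType) (T : finType).
Implicit Types (G : wdigraph R T) (F D : {set T * T}) (C : {set T}).

(* A simple undirected cycle has at least three vertices. *)
Definition is_tree G : Prop :=
  [/\ vset G != set0,
      {in vset G &, forall u v, connect (uadj (eset G)) u v} &
      forall p : seq T, (2 < size p)%N -> ~ ucycle (uadj (eset G)) p].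

Fact del_edges_sub G D : eset G :\: D \subset setX (vset G) (vset G).
Proof. exact: subset_trans (subsetDl _ _) (eset_sub G). Qed.

Fact del_edges_ge0 G D e : e \in eset G :\: D -> 0 <= wt G e.
Proof. by case/setDP=> eE _; exact: wt_ge0. Qed.

Definition del_edges G D : wdigraph R T :=
  WDigraph (@del_edges_sub G D) (@del_edges_ge0 G D).

Fact induced_sub G C :
  eset G :&: setX C C \subset setX (vset G :&: C) (vset G :&: C).
Proof.
apply/subsetP=> -[u v]; rewrite !inE => /andP[/(subsetP (eset_sub G))].
by rewrite !inE /= => /andP[-> ->].
Qed.

Fact induced_ge0 G C e : e \in eset G :&: setX C C -> 0 <= wt G e.
Proof. by case/setIP=> eE _; exact: wt_ge0. Qed.

Definition induced G C : wdigraph R T :=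
  WDigraph (@induced_sub G C) (@induced_ge0 G C).

Definition component G (x : T) : {set T} :=
  [set v in vset G | connect (uadj (eset G)) x v].

Definition components G : {set {set T}} :=
  [set component G v | v in vset G].

(* Loops and pairs of opposite edges count as directed cycles. *)
Definition is_forest G F : Prop :=
  [/\ F \subset eset G,
      forall u, (#|[set e in F | e.1 == u]| <= 1)%N &
      forall p : seq T, p != [::] -> ~ ucycle (dadj F) p].

Definition forests G : {set {set T * T}} := [set F | `[< is_forest G F >]].

Definition roots G F : {set T} :=
  [set v in vset G | [forall u, (v, u) \notin F]].

Definition weight G F : R := \prod_(e in F) wt G e.

Definition partition_fun G (q : R) : R :=
  \sum_(F in forests G) q ^+ #|roots G F| * weight G F.

Definition forest_law G (q : R) F : R :=
  if F \in forests G
  then q ^+ #|roots G F| * weight G F / partition_fun G q else 0.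

Definition forest_prob G (q : R) (A : pred {set T * T}) : R :=
  \sum_(F | A F) forest_law G q F.

Definition sep_prob G (q : R) (x y : T) : R :=
  forest_prob G q (fun F => ~~ connect (uadj F) x y).

Definition edges_between (u v : T) : {set T * T} := [set (u, v); (v, u)].

(* [x :: z] lists z_0, ..., z_d; the ordinal i : 'I_d stands for the element
   i + 1 of {1, ..., d}, that is for the path edge between z_i and z_(i+1). *)
Definition cut_path G (d : nat) (x : T) (z : d.-tuple T) (I : {set 'I_d}) :
    wdigraph R T :=
  del_edges G
    (\bigcup_(i in I) edges_between (nth x (x :: z) i) (nth x (x :: z) i.+1)).

End Graphs.

(* Main.v *)
Require Import Defs.
From HB Require Import structures.
From mathcomp Require Import all_boot all_order all_algebra.
From mathcomp Require Import boolp reals.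
From mathcomp Require Import zify lra.

(** Two facts drive the formula.

    Trees turn separation into a condition on single edges.  Every edge of a
    tree is a bridge (tree_edge_bridge), so a set F of edges leaves x and y
    disconnected if and only if the path z_0, ..., z_d has an edge of which F
    contains no orientation (separatedE).  Let A(F), called [avoided F], be the set
    of the path edges that F does not use; x and y are separated by F exactly
    when A(F) is nonempty, and inclusion-exclusion writes the indicator of this
    event as the sum over the nonempty subsets I of A(F) of (-1)^(|I|+1)
    (sum_sign_nonempty_subsets).  The forests F with I contained in A(F) are
    exactly the forests of G_I, with the same roots and weights, so exchanging
    the two sums gives

      Z_G(q) U_q(x, y) = sum_(I nonempty) (-1)^(|I|+1) Z_(G_I)(q)

    (sep_prob_cuts).

    Partition functions are multiplicative over connected components
    (partition_fun_components): a forest is the same thing as a choice of one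
    forest in every component, its weight is the product of the weights of the
    pieces, and its number of roots is the sum of their numbers of roots.

    That G_I has |I| + 1 components is again the bridge property: z_0 and the
    far ends z_(i+1) of the removed edges form a system of representatives of
    the components (connect_piece_root, piece_root_separated). *)

Set Implicit Arguments.
Unset Strict Implicit.
Unset Printing Implicit Defensive.

Import Order.TTheory GRing.Theory Num.Theory.

Local Open Scope ring_scope.

(** * Connectivity and connected components *)

Section UndirectedConnectivity.
Variable T : finType.
Implicit Type E : {set T * T}.

Lemma uadj_sym E : symmetric (uadj E).
Proof. by move=> u v; rewrite /uadj eq_sym orbC. Qed.

Lemma uconnect_sym E : connect_sym (uadj E).
Proof. exact/sym_connect_sym/uadj_sym. Qed.

Lemma uadjS E E' : E \subset E' -> subrel (uadj E) (uadj E').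
Proof.
move/subsetP=> sEE' u v /andP[uv /orP[]/sEE' uvE]; rewrite /uadj uv uvE //.
by rewrite orbT.
Qed.

Lemma uconnectS E E' :
  E \subset E' -> subrel (connect (uadj E)) (connect (uadj E')).
Proof.
by move=> sEE'; apply: connect_sub => u v /(uadjS sEE')/connect1.
Qed.

Lemma uconnect_edge E u v : (u, v) \in E -> connect (uadj E) u v.
Proof.
move=> uvE; have [->|uv] := eqVneq u v; first exact: connect0.
by apply: connect1; rewrite /uadj uv uvE.
Qed.

End UndirectedConnectivity.

Section Components.
Variables (R : realType) (T : finType) (G : wdigraph R T).

Lemma eset_vset u v : (u, v) \in eset G -> (u \in vset G) && (v \in vset G).
Proof. by move/(subsetP (eset_sub G)); rewrite inE. Qed.

Lemma uadj_vset u v : uadj (eset G) u v -> (u \in vset G) && (v \in vset G).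
Proof. by case/andP=> _ /orP[]/eset_vset; rewrite // andbC. Qed.

Lemma mem_component v : v \in vset G -> v \in component G v.
Proof. by move=> vG; rewrite inE vG connect0. Qed.

Lemma component_in v : v \in vset G -> component G v \in components G.
Proof. exact: imset_f. Qed.

Lemma component_eqP u v : u \in vset G ->
  reflect (component G u = component G v) (connect (uadj (eset G)) u v).
Proof.
move=> uG; apply: (iffP idP) => [uv | eq_uv].
  apply/setP=> w; rewrite !inE.
  by rewrite (same_connect (@uconnect_sym _ (eset G)) uv).
have := mem_component uG; rewrite eq_uv inE uconnect_sym.
by case/andP.
Qed.

Lemma mem_components C v : C \in components G ->
  (v \in C) = (v \in vset G) && (component G v == C).
Proof.
case/imsetP=> u uG ->; rewrite inE; case: (boolP (v \in vset G)) => //= vG.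
by rewrite uconnect_sym; apply/component_eqP/eqP.
Qed.

Lemma component_edge u v : (u, v) \in eset G -> component G u = component G v.
Proof.
move=> uvG; have /andP[uG _] := eset_vset uvG.
exact/component_eqP/uconnect_edge.
Qed.

(** An edge lies inside the component of its source, so the components
    partition the edges as well as the vertices. *)
Lemma edge_in_component C e : C \in components G -> e \in eset G ->
  (e \in setX C C) = (component G e.1 == C).
Proof.
case: e => u v CG uvG; have /andP[uG vG] := eset_vset uvG.
by rewrite inE !(mem_components _ CG) uG vG /= (component_edge uvG) andbb.
Qed.

End Components.

(** * Rooted forests and their factorization over components *)

Section Forests.
Variables (R : realType) (T : finType).
Implicit Types (G : wdigraph R T) (F : {set T * T}).

Lemma forestsP G F : reflect (is_forest G F) (F \in forests G).
Proof. by rewrite inE; apply: asboolP. Qed.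

Lemma forest_sub G F : F \in forests G -> F \subset eset G.
Proof. by case/forestsP. Qed.

(** Being a forest is inherited by subsets and does not depend on the ambient
    graph beyond containment of the edges.  One statement thus covers passing
    to and from G_I as well as restricting to a component. *)
Lemma subforest G G' F F' :
    F \in forests G -> F' \subset F -> F' \subset eset G' -> F' \in forests G'.
Proof.
case/forestsP=> _ outF acyclicF sF'F sF'G'; apply/forestsP; split=> // [u|p p0].
  apply: leq_trans (outF u); apply/subset_leq_card/subsetP=> e.
  by rewrite !inE => /andP[/(subsetP sF'F)-> ->].
case/andP=> cyc_p uniq_p; apply: (acyclicF p p0); rewrite /ucycle uniq_p andbT.
by apply: sub_cycle cyc_p => u v; apply: (subsetP sF'F).
Qed.

Lemma forests_del_edges G (D : {set T * T}) F :
  (F \in forests (del_edges G D)) = (F \in forests G) && [disjoint F & D].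
Proof.
apply/idP/andP=> [forF | [forF FD]].
  have := forest_sub forF; rewrite subsetD => /andP[sFG ->].
  by split=> //; apply: subforest forF _ sFG.
by apply: (subforest forF) => //; rewrite subsetD (forest_sub forF).
Qed.

End Forests.

Section Factorization.
Variables (R : realType) (T : finType) (G : wdigraph R T) (q : R).
Implicit Types (F : {set T * T}) (C : {set T}).
Implicit Type f : {ffun {set T} -> {set T * T}}.

(** The value set0 outside of the components is the default value that
    [pfamily] imposes on a choice function, so that such choices correspond
    one to one to forests of G. *)
Definition split_forest F : {ffun {set T} -> {set T * T}} :=
  [ffun C => if C \in components G then F :&: setX C C else set0].

Definition glue_forest f : {set T * T} := \bigcup_(C in components G) f C.

Lemma split_forestK F : F \subset eset G -> glue_forest (split_forest F) = F.
Proof.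
move=> sFG; apply/setP=> e; apply/bigcupP/idP=> [[C CG]|eF].
  by rewrite ffunE CG => /setIP[].
have eG := subsetP sFG e eF.
have /andP[uG _] : (e.1 \in vset G) && (e.2 \in vset G).
  by apply: eset_vset; case: (e) eG.
exists (component G e.1); first exact: component_in.
by rewrite ffunE component_in // in_setI eF (edge_in_component (component_in uG)) /=.
Qed.

Section Glue.
Variable f : {ffun {set T} -> {set T * T}}.
Hypothesis f_forest :
  forall C, C \in components G -> f C \in forests (induced G C).

Lemma glue_sub C : C \in components G -> f C \subset eset G :&: setX C C.
Proof. by move=> /f_forest/forest_sub. Qed.

(** Components are disjoint, so an edge of the union can only come from the
    piece of its own component. *)
Lemma mem_glue e : e \in glue_forest f -> e \in f (component G e.1).
Proof.
case/bigcupP=> C CG eC; have /setIP[eG] := subsetP (glue_sub CG) _ eC.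
by rewrite (edge_in_component CG eG) => /eqP->.
Qed.

Lemma glue_forest_sub : glue_forest f \subset eset G.
Proof.
apply/bigcupsP=> C /glue_sub sf; apply: subset_trans sf _; exact: subsetIl.
Qed.

Lemma glue_forestK C : C \in components G -> glue_forest f :&: setX C C = f C.
Proof.
move=> CG; apply/setP=> e; rewrite in_setI; apply/andP/idP=> [[egl eC] | efC].
  have eG := subsetP glue_forest_sub e egl.
  by move: eC (mem_glue egl); rewrite (edge_in_component CG eG) => /eqP->.
have /setIP[_ ->] := subsetP (glue_sub CG) e efC.
by split=> //; apply/bigcupP; exists C.
Qed.

(** A directed path never leaves the component of its first vertex; hence a
    directed cycle of the union would be a directed cycle of one piece. *)
Lemma glue_path u s :
  path (dadj (glue_forest f)) u s -> path (dadj (f (component G u))) u s.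
Proof.
elim: s u => //= v s IHs u /andP[uv vs]; rewrite /dadj (mem_glue uv) /=.
by rewrite (component_edge (subsetP glue_forest_sub _ uv)) IHs.
Qed.

Lemma glue_forestP : glue_forest f \in forests G.
Proof.
apply/forestsP; split=> [|u|[//|u s] _].
- exact: glue_forest_sub.
- case: (boolP (u \in vset G)) => [uG | uG].
    have /f_forest/forestsP[_ outC _] := component_in uG.
    apply: leq_trans (outC u); apply/subset_leq_card/subsetP=> e.
    by rewrite !inE => /andP[/mem_glue eC /eqP<-]; rewrite eC eqxx.
  (* No edge of G leaves a vertex outside of vset G. *)
  rewrite (_ : [set _ in _ | _] = set0) ?cards0 //.
  apply/setP=> -[u' v]; rewrite !inE /=; apply: contraNF uG => /andP[uv /eqP<-].
  by have /andP[] := eset_vset (subsetP glue_forest_sub _ uv).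
- case/andP=> cyc uniq_us; have uG : u \in vset G.
    have [v uv] : exists v, (u, v) \in glue_forest f.
      by case: (s) cyc => [|v s'] /= /andP[uv _]; [exists u | exists v].
    by have /andP[] := eset_vset (subsetP glue_forest_sub _ uv).
  have /f_forest/forestsP[_ _ acyclicC] := component_in uG.
  by apply: (acyclicC (u :: s)); rewrite // /ucycle /= glue_path.
Qed.

End Glue.

Lemma card_roots_split F : F \subset eset G ->
  #|Defs.roots G F| =
    (\sum_(C in components G) #|Defs.roots (induced G C) (F :&: setX C C)|)%N.
Proof.
move=> sFG; rewrite -sum1_card.
rewrite (partition_big (component G) (mem (components G))) /=; last first.
  by move=> v; rewrite inE => /andP[vG _]; apply: component_in.
apply: eq_bigr => C CG; rewrite -sum1_card; apply: eq_bigl => v.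
rewrite !inE (mem_components _ CG) -!andbA.
case: (boolP (v \in vset G)) => //= vG; rewrite andbC.
case: eqP => //= vC; apply: eq_forallb => u; rewrite in_setI.
case: (boolP (_ \in F)) => //= vuF.
by rewrite (edge_in_component CG (subsetP sFG _ vuF)) vC eqxx.
Qed.

Lemma weight_split F : F \subset eset G ->
  weight G F =
    \prod_(C in components G) weight (induced G C) (F :&: setX C C).
Proof.
move=> sFG; rewrite /weight.
rewrite (partition_big (component G \o fst) (mem (components G))) /=; last first.
  move=> [u v] /(subsetP sFG)/eset_vset/andP[uG _]; exact: component_in.
apply: eq_bigr => C CG; apply: eq_bigl => e; rewrite in_setI.
by case: (boolP (e \in F)) => //= eF; rewrite (edge_in_component CG) ?(subsetP sFG).
Qed.

(** Expanding the product of sums gives a sum over the choices of a forest in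
    each component; [split_forest] and [glue_forest] are inverse bijections
    between these choices and the forests of G. *)
Lemma partition_fun_components :
  partition_fun G q =
    \prod_(C in components G) partition_fun (induced G C) q.
Proof.
rewrite /partition_fun (big_distr_big_dep set0).
rewrite (reindex_onto split_forest glue_forest) /=; last first.
  move=> f /pfamilyP[supp_f f_forest]; apply/ffunP=> C; rewrite ffunE.
  case: ifPn => CG; first exact: glue_forestK.
  by apply/esym/eqP; apply: contraNT CG => ?; apply: (subsetP supp_f).
apply: eq_big => [F | F forF].
  apply/idP/andP=> [forF | [/pfamilyP[_ sF] /eqP <-]]; last exact: glue_forestP.
  rewrite split_forestK ?forest_sub //; split=> //; apply/pfamilyP; split.
    by apply/subsetP=> C; rewrite inE ffunE; case: ifP => //; rewrite eqxx.
  move=> C CG; rewrite ffunE CG; apply: (subforest forF); first exact: subsetIl.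
  by apply: setSI; apply: forest_sub.
have sFG := forest_sub forF.
rewrite (card_roots_split sFG) (weight_split sFG) -prodrXr -big_split /=.
by apply: eq_bigr => C CG; rewrite ffunE CG.
Qed.

End Factorization.

(** * Alternating sums over subsets *)

Section InclusionExclusion.
Variable R : realType.

(** The left-hand side is the expansion of the product over i of 1 - [i \in A],
    which vanishes as soon as A has an element. *)
Lemma sum_sign_subsets (I : finType) (A : {set I}) :
  \sum_(J : {set I} | J \subset A) (-1) ^+ #|J| = (A == set0)%:R :> R.
Proof.
pose s i : R := if i \in A then -1 else 0.
transitivity (\prod_i (s i + 1)); last first.
  have [A0 | /set0Pn[i iA]] := eqVneq A set0.
    by rewrite big1 // => i _; rewrite /s A0 inE add0r.
  by rewrite (bigD1 i) //= /s iA addNr mul0r.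
rewrite bigA_distr big_mkcond; apply: eq_bigr => J _.
rewrite -big_mkcond /=; case: ifPn => [/subsetP sJA | /subsetPn[i iJ iA]].
  by rewrite -prodr_const; apply: eq_bigr => i /sJA iA; rewrite /s iA.
by rewrite (bigD1 i) //= /s (negPf iA) mul0r.
Qed.

Lemma sum_sign_nonempty_subsets (I : finType) (A : {set I}) :
  \sum_(J : {set I} | (J != set0) && (J \subset A)) (-1) ^+ #|J|.+1 =
    (A != set0)%:R :> R.
Proof.
have := sum_sign_subsets A; rewrite (bigD1 set0) ?sub0set //= cards0 expr0.
set S := \sum_(J | _) _ => S_eq; transitivity (- S).
  rewrite -sumrN; apply: eq_big => [J|J _]; first by rewrite andbC.
  by rewrite exprS mulN1r.
by case: eqP S_eq => _ /=; lra.
Qed.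

Lemma sum_by_card (d : nat) (f : {set 'I_d} -> R) :
  \sum_(1 <= k < d.+1) (-1) ^+ k.+1 * \sum_(I : {set 'I_d} | #|I| == k) f I =
  \sum_(I : {set 'I_d} | I != set0) (-1) ^+ #|I|.+1 * f I.
Proof.
under eq_bigr do rewrite mulr_sumr.
rewrite (exchange_big_dep xpredT) //= [RHS]big_mkcond; apply: eq_bigr => I _.
under eq_bigl do rewrite eq_sym.
by rewrite big_nat1_eq ltnS card_gt0 -[X in (_ <= X)%N]card_ord max_card andbT.
Qed.

End InclusionExclusion.

(** * Paths in trees and their cuts *)

Section Trees.
Variables (R : realType) (T : finType) (G : wdigraph R T).
Hypothesis G_tree : is_tree G.

(** A simple path from u to v that avoids the edge between them has at least
    two edges, so this edge would close it into a simple cycle of length at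
    least three. *)
Lemma tree_edge_bridge u v : uadj (eset G) u v ->
  ~~ connect (uadj (eset G :\: edges_between u v)) u v.
Proof.
move=> uvE; have [_ _ acyclic] := G_tree.
have sub := uadjS (subsetDl (eset G) (edges_between u v)).
apply/negP=> /connectP[p0 /shortenP[p up uniq_p _] v_last].
case: p => [|w [|w' p]] in up uniq_p v_last *.
- by case/andP: uvE; rewrite v_last eqxx.
- by move: v_last up => /= ->; rewrite /uadj !inE !eqxx !orbT !andbF.
apply: (acyclic [:: u, w, w' & p]); rewrite // /ucycle uniq_p andbT.
by rewrite /cycle rcons_path (sub_path sub up) -v_last uadj_sym.
Qed.

Variables (x y : T) (d : nat) (z : d.-tuple T).
Hypothesis z_path : upath (eset G) x y z.

Local Notation node := (nth x (x :: z)).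
Local Notation pathedge i := (edges_between (node i) (node i.+1)).

Lemma node_last : node d = y.
Proof.
case/and3P: z_path => _ /eqP <- _.
by rewrite (last_nth x) size_tuple.
Qed.

Lemma node_adj i : (i < d)%N -> uadj (eset G) (node i) (node i.+1).
Proof.
case/and3P: z_path => /(pathP x) zP _ _ lt_id.
by have := zP i; rewrite size_tuple; apply.
Qed.

Lemma node_inj i j : (i <= d)%N -> (j <= d)%N -> (node i == node j) = (i == j).
Proof.
case/and3P: z_path => _ _ Uz le_id le_jd.
by rewrite nth_uniq //= size_tuple ltnS.
Qed.

(** The vertices of the path are distinct, so removing some of its edges leaves
    the other ones in place. *)
Lemma node_adj_cut (I : {set 'I_d}) (j : 'I_d) : j \notin I ->
  uadj (eset (cut_path G x z I)) (node j) (node j.+1).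
Proof.
move=> jI; have /andP[neq adj] := node_adj (ltn_ord j).
have in_cut u v : (u, v) \in pathedge j -> (u, v) \in eset G ->
    (u, v) \in eset (cut_path G x z I).
  move=> uvj uvG; rewrite in_setD uvG andbT.
  apply/bigcupP=> -[i iI uvi]; case/negP: jI.
  suff /ord_inj-> : nat_of_ord j = i by [].
  have [lei lej] := (ltn_ord i, ltn_ord j).
  have [lei' lej'] := (ltnW lei, ltnW lej).
  move: uvj uvi; rewrite !inE !xpair_eqE.
  by case/orP=> /andP[/eqP-> /eqP->]; rewrite !node_inj //; lia.
rewrite /uadj neq; case/orP: adj => /in_cut -> //; rewrite ?orbT //.
all: by rewrite !inE eqxx ?orbT.
Qed.

Lemma connect_segment (I : {set 'I_d}) a b : (a <= b <= d)%N ->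
    (forall i : 'I_d, (a <= i < b)%N -> i \notin I) ->
  connect (uadj (eset (cut_path G x z I))) (node a) (node b).
Proof.
case/andP=> le_ab; elim: b => [|b IHb] in le_ab *.
  by move: le_ab; rewrite leqn0 => /eqP->; rewrite connect0.
move=> lt_bd avoidI; case: ltngtP le_ab => // [lt_ab _ | -> _]; last exact: connect0.
apply: connect_trans (IHb lt_ab (ltnW lt_bd) _) _.
  by move=> i /andP[le_ai lt_ib]; apply: avoidI; rewrite le_ai ltnS ltnW.
apply/connect1/(node_adj_cut (j := Ordinal lt_bd))/avoidI.
by rewrite /= ltnSn andbT.
Qed.

(** Otherwise the parts of the path from z_a to z_i and from z_(i+1) to z_b
    would join with a connection between z_a and z_b to a detour around the
    bridge between z_i and z_(i+1). *)
Lemma cut_disconnect (F : {set T * T}) (i : 'I_d) a b :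
    F \subset eset G -> [disjoint F & pathedge i] -> (a <= i < b)%N ->
    (b <= d)%N ->
  ~~ connect (uadj F) (node a) (node b).
Proof.
move=> sFG Fi /andP[le_ai lt_ib] le_bd.
have cutE : eset (cut_path G x z [set i]) = eset G :\: pathedge i.
  by rewrite /= big_set1.
have seg : forall c e, (c <= e <= d)%N -> (e <= i)%N || (i < c)%N ->
    connect (uadj (eset G :\: pathedge i)) (node c) (node e).
  move=> c e ce_d out; rewrite -cutE; apply: connect_segment => // j.
  rewrite inE -val_eqE /=; lia.
apply: contra (tree_edge_bridge (node_adj (ltn_ord i))) => con_ab.
have := ltn_ord i => lt_id.
apply: (@connect_trans _ _ (node a)).
  by rewrite uconnect_sym seg // ?le_ai ?leqnn // ltnW.
apply: (@connect_trans _ _ (node b)); last first.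
  by rewrite uconnect_sym seg // ?lt_ib ?leqnn ?orbT.
apply: uconnectS con_ab; apply/subsetP=> e eF.
by rewrite inE (subsetP sFG) // andbT (disjointFr Fi eF).
Qed.

(** If F contains an orientation of every path edge, it connects x to y along
    the path; if it misses one of them, it misses a bridge between x and y. *)
Lemma separatedE (F : {set T * T}) : F \subset eset G ->
  ~~ connect (uadj F) x y = [exists i : 'I_d, [disjoint F & pathedge i]].
Proof.
move=> sFG; apply/idP/existsP=> [|[i Fi]]; last first.
  by rewrite -node_last; apply: (@cut_disconnect F i 0) => //=.
apply: contraNP => noI; rewrite -node_last.
suff con b : (b <= d)%N -> connect (uadj F) (node 0) (node b) by exact: con.
elim: b => [|b IHb] lt_bd; first exact: connect0.
apply: connect_trans (IHb (ltnW lt_bd)) _.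
have /negP := contra_not (ex_intro _ (Ordinal lt_bd)) noI.
case/pred0Pn=> -[u v] /= /andP[uvF]; rewrite !inE.
case/orP=> /eqP[<- <-]; last rewrite uconnect_sym.
all: exact: uconnect_edge.
Qed.

(** Removing the edges of I cuts the path into |I| + 1 segments.  Each segment
    starts at x (encoded by None) or just after a removed edge i (encoded by
    Some i); these starting points represent the components of G_I. *)
Definition piece_root (o : option 'I_d) : T :=
  if o is Some i then node i.+1 else x.

Definition piece_index (I : {set 'I_d}) : {set option 'I_d} :=
  None |: [set Some i | i in I].

Lemma card_piece_index (I : {set 'I_d}) : #|piece_index I| = #|I|.+1.
Proof.
rewrite cardsU1 card_imset; last by move=> i j [].
by rewrite (_ : None \notin _) //; apply/imsetP=> -[].
Qed.

Lemma piece_root_vset o : x \in vset G -> piece_root o \in vset G.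
Proof.
by case: o => [i|] // _; have /uadj_vset/andP[] := node_adj (ltn_ord i).
Qed.

(** True for the vertices of the path by walking back to the start of their
    segment.  It then propagates along the edges of G: an edge that is missing
    in G_I ends on the path, where the claim is already known. *)
Lemma connect_piece_root (I : {set 'I_d}) v : x \in vset G -> v \in vset G ->
  exists2 o, o \in piece_index I &
    connect (uadj (eset (cut_path G x z I))) (piece_root o) v.
Proof.
move=> xG vG; set E := eset _; pose P u := exists2 o, o \in piece_index I &
  connect (uadj E) (piece_root o) u.
have P_node j : (j <= d)%N -> P (node j).
  elim: j => [|j IHj] lt_jd.
    by exists None; rewrite ?setU11 ?connect0.
  pose i := Ordinal lt_jd; case: (boolP (i \in I)) => iI.
    exists (Some i); last exact: connect0.
    by rewrite inE imset_f ?orbT.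
  have [o oI con_o] := IHj (ltnW lt_jd); exists o => //.
  exact/(connect_trans con_o)/connect1/(node_adj_cut iI).
have P_step u w : uadj (eset G) u w -> P u -> P w.
  move=> uw [o oI con_o].
  have [uwE | ] := boolP (uadj E u w).
    by exists o => //; apply/(connect_trans con_o)/connect1.
  move: uw => /andP[neq adj]; rewrite /uadj neq /= negb_or => /andP[].
  have on_path i : i \in I -> (u, w) \in pathedge i -> P w.
    move=> iI; rewrite !inE => /orP[]/eqP[_ ->]; first exact: (P_node i.+1).
    exact/P_node/ltnW.
  have removed e : e \in eset G -> e \notin E ->
      exists2 i, i \in I & e \in pathedge i.
    move=> eG; rewrite in_setD eG andbT negbK => /bigcupP[i].
    by exists i.
  case/orP: adj => /removed rem uwE wuE; first by have [i /on_path] := rem uwE.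
  have [i iI wu] := rem wuE; apply: on_path iI _.
  by move: wu; rewrite !inE orbC !xpair_eqE andbC [X in _ || X]andbC.
have [_ conG _] := G_tree; have /connectP[p xp ->] := conG x v xG vG.
have: P x by apply: (P_node 0).
elim: p x xp => //= w p IHp u /andP[uw wp] Pu.
exact/(IHp _ wp)/(P_step _ _ uw).
Qed.

(** The vertices of the path before z_(k+1) lie on the other side of the bridge
    k, which is removed.  Any two segments are in this position, after an
    exchange if necessary, so their starts lie in different components. *)
Lemma piece_root_separated (I : {set 'I_d}) (o : option 'I_d) (k : 'I_d) :
    k \in I -> (if o is Some i then i < k else true)%N ->
  ~~ connect (uadj (eset (cut_path G x z I))) (piece_root o) (piece_root (Some k)).
Proof.
move=> kI lt_ok.
have lt_kd := ltn_ord k.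
(* The position on the path of the vertex piece_root o. *)
pose a := if o is Some i then i.+1 else 0%N.
have -> : piece_root o = node a by rewrite /a; case: (o).
apply: (@cut_disconnect _ k) => //; first exact: subsetDl.
- apply/pred0P=> e; apply/negP=> /andP[] /=.
  by rewrite inE => /andP[/bigcupP noI _] ek; apply: noI; exists k.
- by rewrite /a ltnSn andbT; case: (o) lt_ok.
Qed.

Lemma card_components_cut (I : {set 'I_d}) : x \in vset G ->
  #|components (cut_path G x z I)| = #|I|.+1.
Proof.
move=> xG; set H := cut_path G x z I.
have root_vset o : piece_root o \in vset H by apply: piece_root_vset.
have -> : components H = [set component H (piece_root o) | o in piece_index I].
  apply/setP=> C; apply/imsetP/imsetP=> [[v vG ->]|[o _ ->]]; last first.
    by exists (piece_root o).
  have [o oI con_o] := connect_piece_root I xG vG; exists o => //.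
  exact/esym/component_eqP.
rewrite -card_piece_index card_in_imset // => o o' oI o'I /component_eqP.
move/(_ (root_vset o)); apply: contraTeq => neq_oo'.
have SomeI k : Some k \in piece_index I -> k \in I.
  by rewrite !inE => /imsetP[k' ? [->]].
have sep := piece_root_separated.
case: o o' oI o'I neq_oo' => [i|] [j|] // oI o'I neq_oo'.
- have: val i != j by apply: contraNneq neq_oo' => /val_inj->.
  case: ltngtP => // [lt_ij | lt_ji] _; last rewrite uconnect_sym.
    by apply: sep => //; apply: SomeI.
  by apply: sep => //; apply: SomeI.
- by rewrite uconnect_sym; apply: sep => //; apply: SomeI.
- by apply: sep => //; apply: SomeI.
Qed.

(** * Separation in the random forest *)

Variable q : R.

Definition avoided (F : {set T * T}) : {set 'I_d} :=
  [set i : 'I_d | [disjoint F & pathedge i]].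

Lemma partition_fun_cut (I : {set 'I_d}) :
  partition_fun (cut_path G x z I) q =
    \sum_(F in forests G | I \subset avoided F)
      q ^+ #|Defs.roots G F| * weight G F.
Proof.
apply: eq_bigl => F; rewrite forests_del_edges; congr (_ && _).
apply/bigcup_disjointP/subsetP => disj i /disj; by rewrite inE.
Qed.

(** Inclusion-exclusion over the set of path edges that the random forest
    avoids. *)
Lemma sep_prob_cuts :
  sep_prob G q x y = (partition_fun G q)^-1 *
    \sum_(I : {set 'I_d} | I != set0)
      (-1) ^+ #|I|.+1 * partition_fun (cut_path G x z I) q.
Proof.
rewrite /sep_prob /forest_prob; set Z := partition_fun G q.
transitivity (\sum_(F in forests G)
    Z^-1 * (q ^+ #|Defs.roots G F| * weight G F * (avoided F != set0)%:R)).
  rewrite big_mkcond [RHS]big_mkcond; apply: eq_bigr => F _.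
  rewrite /forest_law; case: ifPn => [|con]; case: ifPn => // forF.
    rewrite separatedE ?forest_sub // => /existsP[i Fi].
    rewrite (_ : avoided F != set0) ?mulr1; first by rewrite mulrC.
    by apply/set0Pn; exists i; rewrite inE.
  rewrite (_ : avoided F = set0) ?eqxx ?mulr0 //.
  apply/setP=> i; rewrite !inE; apply: contraNF con => Fi.
  by rewrite separatedE ?forest_sub //; apply/existsP; exists i.
rewrite -mulr_sumr; congr (_ * _).
under eq_bigr do rewrite -sum_sign_nonempty_subsets mulr_sumr.
rewrite (exchange_big_dep (fun I => I != set0)) /=; last by move=> F I _ /andP[].
apply: eq_bigr => I I0; rewrite partition_fun_cut mulr_sumr.
by apply: eq_big => [F|F _]; rewrite ?I0 // mulrC.
Qed.

End Trees.

Theorem proposition1 (R : realType) (T : finType) (G : wdigraph R T)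
    (x y : T) (d : nat) (z : d.-tuple T) (q : R)
    (G_tree : is_tree G) (xG : x \in vset G) (yG : y \in vset G)
    (xy : x != y) (dxy : is_udist (eset G) x y d)
    (z_path : upath (eset G) x y z) (q_gt0 : 0 < q) :
  [/\ forall I : {set 'I_d}, #|components (cut_path G x z I)| = #|I|.+1,
      sep_prob G q x y =
        (partition_fun G q)^-1 *
        (\sum_(1 <= k < d.+1)
           (-1) ^+ k.+1 *
           \sum_(I : {set 'I_d} | #|I| == k)
             \prod_(C in components (cut_path G x z I))
               partition_fun (induced (cut_path G x z I) C) q) &
      d = 1%N ->
      let H := del_edges G (edges_between x y) in
      sep_prob G q x y =
        partition_fun (induced H (component H x)) q *
        partition_fun (induced H (component H y)) q / partition_fun G q].
Proof.
have sepE := sep_prob_cuts G_tree z_path q.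
split=> [I||d1 H].
- exact: (card_components_cut G_tree z_path).
- rewrite sum_by_card sepE; congr (_ * _); apply: eq_bigr => I _.
  by rewrite partition_fun_components.
- subst d; rewrite sepE mulrC; congr (_ / _).
  (* The only nonempty set of path edges is the whole path. *)
  rewrite (big_pred1 [set ord0]) => [|I]; last first.
    apply/set0Pn/eqP => [[i iI]|->]; last by exists ord0; rewrite inE.
    by apply/setP=> j; rewrite inE !ord1 eqxx -(ord1 i).
  have node1 : nth x z 0 = y by have := node_last z_path.
  have cutH : cut_path G x z [set ord0] = H.
    by rewrite /cut_path big_set1 /= node1.
  have not_con : ~~ connect (uadj (eset H)) x y.
    by have := tree_edge_bridge G_tree (node_adj z_path (ltn0Sn 0)); rewrite /= node1.
  have Cxy : component H x != component H y.
    by apply: contra not_con => /eqP/(@component_eqP _ _ H _ _ xG).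
  have compsH : components H = [set component H x; component H y].
    apply/eqP; rewrite eq_sym eqEcard; apply/andP; split.
      by apply/subsetP=> C /set2P[]->; apply: component_in.
    have := card_components_cut G_tree z_path [set ord0] xG.
    by rewrite cutH cards2 Cxy cards1 => ->.
  rewrite cutH cards1 sqrrN expr1n mul1r partition_fun_components compsH.
  by rewrite big_setU1 ?inE //= big_set1.
Qed.
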